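(* Let $G=H_{n,p}$ and suppose $G$ is $S$-magic for a set $S$, with $\theta(G)=1$ and $S$-magic constant $\frac{n^2p+n+1}{2}(p-1)$. Then there exists a set $S'$ such that $G$ is $S'$-magic with $\theta(G)=1$ and $S'$-magic constant $\frac{n^2p+3n-1}{2}(p-1)$.
   Context: $H_{n,p}$ denotes the complete multipartite graph with $p$ parts each having exactly $n$ vertices. For a finite set $S$ of positive integers with $|S|=|V(G)|$, a graph $G$ is $S$-magic if there is a bijection $f:V(G)\to S$ and a constant $c$ (the $S$-magic constant) with $\sum_{v\in N(u)} f(v)=c$ for every vertex $u$, where $N(u)$ is the set of neighbours of $u$. Let $\alpha(S)=\max S$ and $i(G)=\min \alpha(S)$ over all $S$ for which $G$ is $S$-magic; the distance magic index is $\theta(G)=i(G)-|V(G)|$. When $\theta(G)=1$, the relevant sets are of the form $S=\{1,\dots,|V(G)|+1\}\setminus\{a\}$ with $a\in\{1,\dots,|V(G)|\}$. *)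

(* Defs.v *)
From HB Require Import structures.
From mathcomp Require Import all_boot all_order all_algebra.
From mathcomp Require Import finmap.

Set Implicit Arguments.
Unset Strict Implicit.
Unset Printing Implicit Defensive.

Import Order.TTheory GRing.Theory Num.Theory.

Local Open Scope ring_scope.
Local Open Scope fset_scope.

Record sgraph := SGraph {
  svertex :> finType;
  sedge : rel svertex;
  sedge_sym : symmetric sedge;
  sedge_irrefl : irreflexive sedge
}.

(* H_{n,p}: the vertex (i, j) is the j-th vertex of the i-th part. *)
Section CompleteMultipartite.
Variables n p : nat.

Definition multipartite_rel : rel ('I_p * 'I_n)%type :=
  fun u v => u.1 != v.1.

Fact multipartite_sym : symmetric multipartite_rel.
Proof. by move=> u v; rewrite /multipartite_rel eq_sym. Qed.

Fact multipartite_irrefl : irreflexive multipartite_rel.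
Proof. by move=> u; rewrite /multipartite_rel eqxx. Qed.

Definition complete_multipartite : sgraph :=
  SGraph multipartite_sym multipartite_irrefl.

End CompleteMultipartite.

(* The constant is taken in rat so that halves are not truncated. *)
Definition magic_with_constant (G : sgraph) (S : {fset nat}) (c : rat) : Prop :=
  [/\ forall x, x \in S -> (0 < x)%N,
      #|` S| = #|G|
    & exists2 f : G -> S, bijective f &
        forall u : G, (\sum_(v : G | sedge u v) val (f v))%N%:R = c].

Definition magic (G : sgraph) (S : {fset nat}) : Prop :=
  exists c, magic_with_constant G S c.

(* max S, with value 0 on the empty set. *)
Definition alpha (S : {fset nat}) : nat := (\max_(x <- S) x)%N.

(* i(G) = i; no such i exists when G is S-magic for no S. *)
Definition is_magic_min (G : sgraph) (i : nat) : Prop :=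
  (exists2 S, magic G S & alpha S = i) /\
  (forall S, magic G S -> (i <= alpha S)%N).

(* theta(G) = t, as a relation since i(G) need not exist. *)
Definition is_distance_magic_index (G : sgraph) (t : int) : Prop :=
  exists2 i : nat, is_magic_min G i & t = i%:Z - #|G|%:Z.

(* S = {1, ..., |V(G)| + 1} \ {a} with 1 <= a <= |V(G)|. *)
Definition index_one_set (G : sgraph) (S : {fset nat}) : Prop :=
  exists2 a : nat, (1 <= a <= #|G|)%N &
    S = [fset x in iota 1 #|G|.+1 | x != a].

(* Main.v *)
Require Import Defs.
From HB Require Import structures.
From mathcomp Require Import all_boot all_order all_algebra.
From mathcomp Require Import finmap zify ring lra.

Import Order.TTheory GRing.Theory Num.Theory.

Local Open Scope ring_scope.
Local Open Scope fset_scope.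

(** Write N = n p and let a be the label missing from S.  The reflection
    x |-> N + 2 - x maps S onto {1, ..., N + 1} minus N + 2 - a, and since the
    graph is regular of degree (p - 1) n it turns a labelling of constant c into
    one of constant (p - 1) n (N + 2) - c.  It remains to see that the new
    missing label is at most N, i.e. that a <> 1.  Summing the magic condition
    over all vertices gives N c = (p - 1) n (sum of S); for a = 1 and p >= 2 this
    would force p = 2 n p.  When p = 1 both constants are 0 and S' = S works. *)

Definition regular (G : sgraph) (d : nat) : Prop :=
  forall u : G, #|[pred v | sedge u v]| = d.

Lemma multipartite_regular n p :
  regular (complete_multipartite n p) (p.-1 * n).
Proof.
move=> [i j] /=.
rewrite (@eq_card _ _ (predX (predC1 i) (@predT 'I_n))); last first.
  by move=> [k l]; rewrite !inE /= /multipartite_rel /= eq_sym andbT.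
by rewrite cardX cardC1 !card_ord.
Qed.

Lemma card_multipartite n p : #|complete_multipartite n p| = (n * p)%N.
Proof. by rewrite /= card_prod !card_ord mulnC. Qed.

Definition reflect_set (m : nat) (S : {fset nat}) : {fset nat} :=
  [fset (m - x)%N | x in S].

(** Each label and its reflection add up to [m], so over the [d] neighbours of a vertex the old and
    new sums total [d * m]. The strict bound keeps reflected labels positive and makes truncated
    subtraction injective on [S]. *)
Lemma reflect_magic {G : sgraph} {d m : nat} {S : {fset nat}} {c : rat} :
  regular G d -> (forall x, x \in S -> x < m)%N ->
  magic_with_constant G S c ->
  magic_with_constant G (reflect_set m S) ((d * m)%:R - c).
Proof.
move=> regG ltSm [_ cardS [f bij_f magic_f]].
have inj_refl : {in S &, injective (fun x => m - x)%N}.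
  by move=> x y /ltSm ? /ltSm ?; lia.
have cardS' : #|` reflect_set m S| = #|G| by rewrite card_in_imfset.
split=> [x /imfsetP [y /= /ltSm ltym ->]||]; first by rewrite subn_gt0.
  exact: cardS'.
have memS' u : (m - val (f u))%N \in reflect_set m S.
  by apply/imfsetP; exists (val (f u)) => //; exact: valP.
exists (fun u => [` memS' u]) => [|u].
  apply: inj_card_bij => [u v /(congr1 val) /= eq_uv|].
    apply: (bij_inj bij_f); apply: val_inj.
    exact: inj_refl (valP (f u)) (valP (f v)) eq_uv.
  by rewrite -cardfE cardS'.
rewrite -(magic_f u) -(regG u) /= -sum_nat_const.
apply/eqP; rewrite eq_sym subr_eq -natrD -big_split /=; apply/eqP.
congr (_%:R); apply: eq_bigr => v _.
by rewrite subnK // ltnW // ltSm //; exact: valP.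
Qed.

(** Double counting: in the sum of all neighbourhood sums, the label of [v] occurs once for each of
    its [d] neighbours. *)
Lemma regular_magic_sum {G : sgraph} {d : nat} {S : {fset nat}} {c : rat} :
  regular G d -> magic_with_constant G S c ->
  #|G|%:R * c = (d * \sum_(x <- S) x)%:R.
Proof.
move=> regG [_ _ [f [g fK gK] magic_f]].
have -> : #|G|%:R * c = (\sum_(u : G) \sum_(v : G | sedge u v) val (f v))%:R.
  rewrite natr_sum (eq_bigr (fun=> c)) => [|u _]; last exact: magic_f.
  by rewrite sumr_const mulr_natl.
congr (_%:R); rewrite (exchange_big_dep xpredT) //= big_distrr /=.
rewrite big_seq_fsetE (reindex f) /=; last by exists g => ? _.
apply: eq_bigr => v _; rewrite sum_nat_const -(regG v); congr (_ * _)%N.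
by apply: eq_card => u; rewrite !inE sedge_sym.
Qed.

Lemma sum_fset_iota_without (N a : nat) : (1 <= a <= N)%N ->
  ((\sum_(x <- [fset x in iota 1 N | x != a]) x + a).*2 = N * N.+1)%N.
Proof.
move=> a_bounds.
have perm_fset : perm_eq [fset x in iota 1 N | x != a]
                         [seq x <- iota 1 N | x != a].
  apply: uniq_perm; rewrite ?fset_uniq ?filter_uniq ?iota_uniq // => x.
  by rewrite !inE mem_filter andbC.
rewrite (perm_big _ perm_fset) big_filter /= addnC.
(* Putting [a] back completes the triangular sum. *)
rewrite -(@bigD1_seq _ _ _ _ (iota 1 N) a id) ?iota_uniq ?mem_iota //=.
have -> : iota 1 N = index_iota 1 N.+1 by rewrite /index_iota subn1.
elim: N {a_bounds perm_fset} => [|N IHN]; first by rewrite big_geq.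
by rewrite big_nat_recr //= doubleD IHN; lia.
Qed.

Lemma reflect_iota_without (N a : nat) : (1 <= a <= N)%N ->
  reflect_set N.+1 [fset x in iota 1 N | x != a]
  = [fset x in iota 1 N | x != N.+1 - a]%N.
Proof.
move=> a_bounds; apply/fsetP => x; rewrite !inE mem_iota /=.
apply/imfsetP/idP => [[y /=]|x_in].
  by rewrite !inE mem_iota /= => y_in ->; lia.
by exists (N.+1 - x)%N; rewrite /= ?inE ?mem_iota; lia.
Qed.

Theorem theorem12 (n p : nat) (S : {fset nat})
  (htheta : is_distance_magic_index (complete_multipartite n p) 1)
  (hS : index_one_set (complete_multipartite n p) S)
  (hmagic : magic_with_constant (complete_multipartite n p) S
     ((n%:R ^+ 2 * p%:R + n%:R + 1) / 2 * (p%:R - 1))) :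
  exists S' : {fset nat},
    [/\ is_distance_magic_index (complete_multipartite n p) 1,
        index_one_set (complete_multipartite n p) S'
      & magic_with_constant (complete_multipartite n p) S'
          ((n%:R ^+ 2 * p%:R + 3 * n%:R - 1) / 2 * (p%:R - 1))].
Proof.
case: hS => a; rewrite card_multipartite => a_bounds defS.
have [p_le1|p_gt1] := leqP p 1.
  (* [p = 0] is excluded by [a_bounds], which would read 1 <= a <= 0. *)
  have p1 : p = 1%N by nia.
  exists S; split=> //; first by exists a; rewrite card_multipartite.
  by move: hmagic; rewrite p1 subrr !mulr0.
have regG := multipartite_regular n p.
have a_neq1 : a != 1%N.
  apply/eqP => a1; have := regular_magic_sum regG hmagic.
  have := @sum_fset_iota_without (n * p).+1 a ltac:(lia).
  rewrite -defS card_multipartite a1; set T := (\sum_(x <- S) x)%N => sumS Nc.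
  have sumSQ : 2 * (T%:R + 1) = (n%:R * p%:R + 1) * (n%:R * p%:R + 2) :> rat.
    have : (2 * (T + 1))%:R = ((n * p + 1) * (n * p + 2))%:R :> rat.
      by congr (_%:R); lia.
    by rewrite !(natrM, natrD).
  have p1E : p.-1%:R = p%:R - 1 :> rat by rewrite -subn1 natrB // ltnW.
  have n_neq0 : n%:R != 0 :> rat by rewrite pnatr_eq0; nia.
  have p_neq1 : p%:R - 1 != 0 :> rat by rewrite -p1E pnatr_eq0; lia.
  move: Nc; rewrite !natrM p1E => Nc.
  (* After cancelling n (p - 1) and doubling, [Nc] reads p (n^2 p + n + 1) = (n p + 1)(n p + 2) - 2;
     the terms n^2 p^2 cancel and n p + p = 3 n p remains. *)
  have : (p%:R : rat) = (2 * n * p)%:R.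
    rewrite !natrM; apply: (mulfI n_neq0); apply: (mulfI p_neq1).
    have TE : (T%:R : rat) = (n%:R * p%:R + 1) * (n%:R * p%:R + 2) / 2 - 1.
      by lra.
    move: Nc; rewrite TE.
    by move: (n%:R : rat) (p%:R : rat) => x y Nc; lra.
  have n_gt0 : (0 < n)%N by nia.
  move/eqP; rewrite eqr_nat => /eqP p_eq.
  have : (p * 1 < p * (2 * n))%N by rewrite ltn_mul2l; lia.
  by lia.
exists (reflect_set (n * p).+2 S); split=> //.
  (* The new missing label is at least 2 because a <= n p, and at most n p because a >= 2. *)
  exists ((n * p).+2 - a)%N; rewrite card_multipartite; first by lia.
  by rewrite defS reflect_iota_without //; lia.
have ltS x : x \in S -> (x < (n * p).+2)%N.
  by rewrite defS !inE mem_iota; lia.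
have := reflect_magic regG ltS hmagic; congr magic_with_constant.
(* With the factor (p - 1) / 2 taken out, this is 2 n (n p + 2) - (n^2 p + n + 1) = n^2 p + 3 n -
   1. *)
rewrite -[(n * p).+2]addn2 !natrM natrD natrM -subn1 natrB ?(ltnW p_gt1) //.
by field.
Qed.
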